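(* Let $(X,S,G,\mathcal{B})$ be an $n$-dimensional building-like complex. Then for $0 \leq k \leq n-1$, $$h_{k}(X) \geq \left(\binom{n+1}{k+2}a_{k}\right)^{-1}.$$
   Context: All homology and cohomology is with $\mathbb{F}_2$ coefficients. Let $X$ be a finite $n$-dimensional pure simplicial complex, $X(k)$ its set of $k$-faces, $f_k(X)=|X(k)|$, and $X^{(n-1)}$ its $(n-1)$-skeleton. For $\sigma\in X(k)$ let $c(\sigma)$ be the number of $n$-faces containing $\sigma$ and $w(\sigma)=\frac{c(\sigma)}{\binom{n+1}{k+1}f_n(X)}$. For a cochain $\phi\in C^k(X)$, $\|\phi\|=\sum_{\sigma\in X(k):\phi(\sigma)\neq 0}w(\sigma)$ and $\|[\phi]\|=\min\{\|\phi+d_{k-1}\psi\|:\psi\in C^{k-1}(X)\}$. The $k$-th coboundary expansion constant is $h_k(X)=\min\{\|d_k\phi\|/\|[\phi]\|:\phi\in C^k(X)\setminus B^k(X)\}$. Let $G$ be a subgroup of $\mathrm{Aut}(X)$, $S$ a finite $G$-set, and for $0\le k\le n-1$ (and also $k=-1$, with the empty simplex) let $\mathcal{F}_k=S\times X(k)$ with $G$-action $g(s,\tau)=(gs,g\tau)$. Let $\mathcal{B}=\{B_{s,\tau}:-1\le k<n,(s,\tau)\in\mathcal{F}_k\}$ be a family of subcomplexes of $X$ with $\tau\in B_{s,\tau}\subset B_{s,\tau'}$ for all $s\in S$ and $\tau\subset\tau'\in X^{(n-1)}$. The 4-tuple $(X,S,G,\mathcal{B})$ is a building-like complex if: (C1)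 $G$ is transitive on $X(n)$; (C2) $gB_{s,\tau}=B_{gs,g\tau}$ for all $g\in G$, $(s,\tau)\in S\times X^{(n-1)}$; (C3) $\tilde H_i(B_{s,\tau})=0$ for all $(s,\tau)\in\mathcal{F}_k$ and $-1\le i\le k<n$. For $0\le k\le n-1$, $a_k=\max\{|G\eta\cap B_{s,\tau}(k+1)|:\eta\in X(k+1),(s,\tau)\in\mathcal{F}_k\}$, where $G\eta$ is the $G$-orbit of $\eta$. *)

(* Defs.v *)
From HB Require Import structures.
From mathcomp Require Import all_boot all_order all_algebra all_fingroup.

Set Implicit Arguments.
Unset Strict Implicit.
Unset Printing Implicit Defensive.

Import Order.TTheory GRing.Theory Num.Theory.
Local Open Scope ring_scope.

Section Complexes.
Variable V : finType.
Implicit Types (X Y : {set {set V}}) (sigma tau : {set V}).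

(* The empty simplex is a face, so that chain complexes are augmented. *)
Definition simplicial_complex X : Prop :=
  set0 \in X /\
  (forall sigma tau, tau \in X -> sigma \subset tau -> sigma \in X).

(* V is exactly the vertex set; this makes the automorphism group of X a
   subgroup of {perm V}. Purity: every facet has dimension n. *)
Record pure_complex (n : nat) X : Prop := PureComplex {
  pure_complex_sc : simplicial_complex X;
  pure_complex_vertex : forall v : V, [set v] \in X;
  pure_complex_facet : forall sigma, maxset [in X] sigma -> #|sigma| = n.+1
}.

(* Faces are indexed by cardinality: X(k) is [faces X k.+1], and
   X(-1) = {set0} is [faces X 0]. *)
Definition faces X (m : nat) : {set {set V}} := [set sigma in X | #|sigma| == m].

End Complexes.

Notation face X m := {sigma : {set _} | sigma \in faces X m}.
(* C^(m-1)(X) and, since coefficients are in F_2, also C_(m-1)(X). *)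
Notation cochain X m := {ffun face X m -> 'F_2}.

Section Cochains.
Variable V : finType.
Implicit Types X : {set {set V}}.

Definition coboundary X m (phi : cochain X m) : cochain X m.+1 :=
  [ffun tau : face X m.+1 =>
     \sum_(sigma : face X m | val sigma \subset val tau) phi sigma].

Definition boundary X m (z : cochain X m.+1) : cochain X m :=
  [ffun sigma : face X m =>
     \sum_(tau : face X m.+1 | val sigma \subset val tau) z tau].

Definition cycles X m : {set cochain X m} :=
  match m return {set cochain X m} with
  | 0 => setT
  | m'.+1 => [set z | boundary z == 0]
  end.

Definition boundaries X m : {set cochain X m} :=
  [set boundary c | c : cochain X m.+1].

(* Vanishing of the reduced homology group in dimension m - 1. *)
Definition reduced_homology_vanishes X m : Prop := cycles X m = boundaries X m.

(* B^m(X), a subset of C^m(X) = cochain X m.+1. *)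
Definition coboundaries X m : {set cochain X m.+1} :=
  [set coboundary psi | psi : cochain X m].

Section Norms.
Variables (n : nat) (X : {set {set V}}).

Definition weight (sigma : {set V}) : rat :=
  #|[set tau in faces X n.+1 | sigma \subset tau]|%:R /
    ('C(n.+1, #|sigma|) * #|faces X n.+1|)%:R.

Definition norm m (phi : cochain X m) : rat :=
  \sum_(sigma : face X m | phi sigma != 0) weight (val sigma).

End Norms.

End Cochains.

(* The default 0 is never reached below: if X is pure of dimension n and k < n,
   then no k-face is a facet, so C^k(X) contains cochains outside B^k(X). *)
Definition fin_min (I : finType) (P : pred I) (F : I -> rat) : rat :=
  if [pick i | P i] is Some i0 then F [arg min_(i < i0 | P i) F i]%O else 0.

Section Expansion.
Variables (V : finType) (n : nat) (X : {set {set V}}).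

Definition cohomology_norm m (phi : cochain X m.+1) : rat :=
  fin_min predT (fun psi : cochain X m => norm n (phi + coboundary psi)).

Definition expansion (k : nat) : rat :=
  fin_min [pred phi : cochain X k.+1 | phi \notin coboundaries X k]
    (fun phi => norm n (coboundary phi) / cohomology_norm phi).

End Expansion.

Section BuildingLike.
Variables (V : finType) (n : nat) (X : {set {set V}}).
Variables (S : finType) (G : {group {perm V}}) (to : action G S).
Variable B : S -> {set V} -> {set {set V}}.

(* [B s tau] is only relevant for tau in the (n-1)-skeleton, the empty simplex
   included. Since (g * h) x = h (g x) in {perm V}, the right action [to] is a
   left action for the usual composition of automorphisms. *)
Record building_like : Prop := BuildingLike {
  bl_pure : pure_complex n X;
  bl_aut : G \subset ('N(X | 'P^*))%g;
  bl_subcomplex : forall s (tau : {set V}), tau \in X -> (#|tau| <= n)%N ->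
    simplicial_complex (B s tau) /\ B s tau \subset X;
  bl_mem : forall s (tau : {set V}), tau \in X -> (#|tau| <= n)%N -> tau \in B s tau;
  bl_mono : forall s (tau tau' : {set V}), tau' \in X -> (#|tau'| <= n)%N ->
    tau \subset tau' -> B s tau \subset B s tau';
  bl_transitive : [transitive G, on faces X n.+1 | 'P^*]%g;
  bl_equivariant : forall g s (tau : {set V}), g \in G -> tau \in X -> (#|tau| <= n)%N ->
    ('P^*^*)%act (B s tau) g = B (to s g) (('P^*)%act tau g);
  bl_acyclic : forall s (tau : {set V}) m, tau \in X -> (#|tau| <= n)%N ->
    (m <= #|tau|)%N -> reduced_homology_vanishes (B s tau) m
}.

Definition orbit_bound (k : nat) : nat :=
  \max_(eta in faces X k.+2) \max_(s : S) \max_(tau in faces X k.+1)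
    #|orbit 'P^* G eta :&: faces (B s tau) k.+2|.

End BuildingLike.

(* Main.v *)
(* Fix s in S. Acyclicity of the subcomplexes B s tau gives, by induction on the
   dimension of tau, a cone chain c(tau) in B s tau with
     bd c(tau) = tau + sum of c(tau') over the facets tau' of tau.
   Dually, (iota phi)(tau) = <c(tau), phi> is a contracting homotopy, so that
   phi + d(iota phi) = iota(d phi) and ||[phi]|| <= ||iota(d phi)||. The same
   bound holds for each conjugate of the cone by g in G. Summing over G, a face
   eta in the support of d phi is counted at most a_k |Stab eta| times for each
   tau, the weights of the faces tau add up to at most 1, and transitivity on
   the n-faces gives |Stab eta| <= |G| C(n+1, k+2) w(eta).

   Conjugating a single cone replaces the equivariant choice of cones, so one
   s suffices. *)
Require Import Defs.
From HB Require Import structures.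
From mathcomp Require Import all_boot all_order all_algebra all_fingroup.

Set Implicit Arguments.
Unset Strict Implicit.
Unset Printing Implicit Defensive.

Import Order.TTheory GRing.Theory Num.Theory.
Local Open Scope ring_scope.

(** * Cancellation in characteristic two *)

Lemma addF2 (x : 'F_2) : x + x = 0.
Proof. by apply: addrr_pchar2; apply: pchar_Fp. Qed.

(** The terms at [(v, w)] and [(w, v)] cancel. Comparing [enum_rank] cuts the sum into two halves
    that the swap exchanges. *)
Lemma sum_symmetric_F2 (T : finType) (A : {set T}) (F : T -> T -> 'F_2) :
  (forall v w, F v w = F w v) ->
  \sum_(v in A) \sum_(w in A :\ v) F v w = 0.
Proof.
move=> Fsym; rewrite pair_big_dep /=.
rewrite (bigID (fun p : T * T => (enum_rank p.1 < enum_rank p.2)%N)) /=.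
rewrite [X in _ + X](reindex_onto (fun p => (p.2, p.1)) (fun p => (p.2, p.1))) /=;
  last by case.
rewrite -[RHS](addF2 (\sum_(i | [&& i.1 \in A, i.2 \in A :\ i.1
   & (enum_rank i.1 < enum_rank i.2)%N]) F i.1 i.2)).
congr (_ + _); first by apply: eq_bigl => p; rewrite andbA.
apply: eq_big => [[v w]|[v w] _] /=; last exact: Fsym.
rewrite !in_setD1 eqxx andbT -leqNgt ltn_neqAle (inj_eq val_inj) (inj_eq enum_rank_inj).
by rewrite [v == w]eq_sym; do 2!case: (_ \in A); case: (w == v).
Qed.

(** * Chains and cochains as functions on all subsets of the vertex set *)

Section SetChains.
Variable V : finType.
Implicit Types (sigma tau eta : {set V}) (X Y : {set {set V}}) (f : {set V} -> 'F_2).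

(* Extension by zero, which lets chains on different complexes be compared. *)
Definition extend X m (phi : cochain X m) sigma : 'F_2 := oapp phi 0 (insub sigma).

Lemma extendE X m (phi : cochain X m) (sigma : face X m) :
  extend phi (val sigma) = phi sigma.
Proof. by rewrite /extend valK. Qed.

Lemma extend_out X m (phi : cochain X m) sigma :
  sigma \notin faces X m -> extend phi sigma = 0.
Proof. by move=> sX; rewrite /extend insubN. Qed.

(** Indexing by the vertex added or removed, instead of by cofaces and facets, turns double sums
    into sums over pairs of vertices, where [sum_symmetric_F2] applies. *)
Definition bd f sigma := \sum_(v in ~: sigma) f (v |: sigma).
Definition cobd f tau := \sum_(v in tau) f (tau :\ v).

Lemma facesP X m sigma : reflect (sigma \in X /\ #|sigma| = m) (sigma \in faces X m).
Proof. by rewrite inE; apply: (iffP andP) => -[? /eqP]. Qed.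

Lemma sub_faces X Y m : X \subset Y -> faces X m \subset faces Y m.
Proof.
move=> /subsetP sXY; apply/subsetP=> sigma /facesP[/sXY ? ?]; exact/facesP.
Qed.

Lemma setU1_out_inj sigma : {in ~: sigma &, injective (fun v => v |: sigma)}.
Proof.
move=> v w; rewrite !inE => vs ws /setP/(_ v).
by rewrite !inE eqxx (negPf vs) !orbF => /esym vw; apply/eqP.
Qed.

Lemma setD1_in_inj tau : {in tau &, injective (fun v => tau :\ v)}.
Proof.
move=> v w vt wt /setP/(_ v).
by rewrite !inE eqxx vt /= andbT => /esym/negbT; rewrite negbK => /eqP.
Qed.

Lemma cofaces_setU1 sigma :
  [set tau : {set V} | sigma \subset tau & #|tau| == #|sigma|.+1]
    = [set v |: sigma | v in ~: sigma].
Proof.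
apply/setP=> tau; rewrite inE; apply/andP/imsetP => [[st /eqP ct]|[v]].
  have /cards1P[v tv] : #|tau :\: sigma| == 1%N.
    by rewrite cardsD (setIidPr st) ct subSnn.
  exists v; first by have := set11 v; rewrite -tv !inE => /andP[].
  by rewrite -tv setUC -[LHS](setID tau sigma) (setIidPr st).
by rewrite inE => vs ->; rewrite subsetUr cardsU1 vs add1n.
Qed.

Lemma facets_setD1 tau :
  [set sigma : {set V} | sigma \subset tau & #|sigma|.+1 == #|tau|]
    = [set tau :\ v | v in tau].
Proof.
apply/setP=> sigma; rewrite inE; apply/andP/imsetP => [[st /eqP ct]|[v vt ->]].
  have /cards1P[v tv] : #|tau :\: sigma| == 1%N.
    by rewrite cardsD (setIidPr st) -ct subSnn.
  have := set11 v; rewrite -tv !inE => /andP[vs vt]; exists v => //.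
  by rewrite -tv setDDr setDv set0U (setIidPr st).
by rewrite subD1set (cardsD1 v tau) vt.
Qed.

Lemma coboundaryE X m (phi : cochain X m) : simplicial_complex X ->
  {in faces X m.+1, extend (coboundary phi) =1 cobd (extend phi)}.
Proof.
move=> [_ Xdown] tau tX; have /facesP[tauX ct] := tX.
rewrite -[tau]/(val (exist (fun s => s \in faces X m.+1) tau tX)) extendE ffunE /=.
under eq_bigr => u _ do rewrite -extendE.
rewrite -(big_sub_cond (faces X m) (fun s => s \subset tau) (extend phi)).
rewrite /cobd -(big_imset (extend phi) (@setD1_in_inj tau)) -facets_setD1 /=.
apply: eq_bigl => s; rewrite !inE ct eqSS.
by case st: (s \subset tau); rewrite ?andbF //= andbT (Xdown _ _ tauX st).
Qed.

Lemma boundaryE X m (z : cochain X m.+1) :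
  {in faces X m, extend (boundary z) =1 bd (extend z)}.
Proof.
move=> sigma sX; have /facesP[sigmaX cs] := sX.
rewrite -[sigma]/(val (exist (fun s => s \in faces X m) sigma sX)) extendE ffunE /=.
under eq_bigr => u _ do rewrite -extendE.
rewrite -(big_sub_cond (faces X m.+1) (fun s => sigma \subset s) (extend z)).
rewrite /bd -(big_imset (extend z) (@setU1_out_inj sigma)) -cofaces_setU1 /=.
rewrite [RHS](bigID (fun t => t \in X)) /= [X in _ + X]big1 ?addr0; last first.
  by move=> t /andP[_ tX]; rewrite extend_out // inE (negPf tX).
by apply: eq_bigl => t; rewrite !inE cs -andbA andbC [(_ == _) && _]andbC.
Qed.

(** Restates acyclicity for functions on subsets, so that chains of different subcomplexes [B s tau]
    can be added without casts. *)
Lemma fill_cycle Y m f : simplicial_complex Y -> reduced_homology_vanishes Y m ->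
    (forall sigma, f sigma != 0 -> sigma \in faces Y m) ->
    (forall sigma, bd f sigma = 0) ->
  exists2 c, (forall sigma, c sigma != 0 -> sigma \in faces Y m.+1)
           & (forall sigma, bd c sigma = f sigma).
Proof.
move=> [_ Ydown] HY fsupp fcyc.
pose z : cochain Y m := [ffun u : face Y m => f (val u)].
have zE sigma : extend z sigma = f sigma.
  have [sY|sY] := boolP (sigma \in faces Y m).
    by rewrite -[sigma]/(val (exist (fun s => s \in faces Y m) sigma sY)) extendE ffunE.
  by rewrite extend_out //; apply/esym/eqP; apply: contraNT sY => /fsupp.
have : z \in cycles Y m.
  (* For [m = 0] every chain counts as a cycle. *)
  case: m @z zE {HY fsupp} => [|m] z zE; first by rewrite inE.
  rewrite inE; apply/eqP/ffunP=> u; rewrite -extendE boundaryE ?(valP u) // ffunE.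
  by rewrite -(fcyc (val u)); apply: eq_bigr => v _; rewrite zE.
rewrite HY => /imsetP[c _ zc]; exists (extend c) => [sigma|sigma].
  by apply: contraR => /extend_out->.
have [sY|sY] := boolP (sigma \in faces Y m).
  by rewrite -boundaryE // -zc zE.
(* Off [faces Y m] both sides vanish: [Y] is closed under subsets, so no coface of [sigma] of size
   [m.+1] lies in [Y]. *)
rewrite -zE extend_out // /bd big1 // => v; rewrite inE => vs.
apply: extend_out; apply: contra sY => /facesP[vY cv]; apply/facesP.
split; first exact: Ydown vY (subsetUr _ _).
by move: cv; rewrite cardsU1 vs => -[].
Qed.

Lemma bdD f g sigma : bd (fun eta => f eta + g eta) sigma = bd f sigma + bd g sigma.
Proof. exact: big_split. Qed.

Lemma bd_sum (A : {set V}) (F : V -> {set V} -> 'F_2) sigma :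
  bd (fun eta => \sum_(v in A) F v eta) sigma = \sum_(v in A) bd (F v) sigma.
Proof. exact: exchange_big. Qed.

Lemma bd_delta tau sigma :
  bd (fun eta => (eta == tau)%:R) sigma = \sum_(v in tau) (sigma == tau :\ v)%:R.
Proof.
rewrite /bd big_mkcond [RHS]big_mkcond; apply: eq_bigr => v _; rewrite inE.
have [vs|vs] /= := boolP (v \in sigma).
  case: ifP => // vt; case: eqP => // st.
  by move: vs; rewrite st !inE eqxx.
case: eqP => [<-|st]; first by rewrite setU11 setU1K ?eqxx.
by case: ifP => // vt; case: eqP => // sE; case: st; rewrite sE setD1K.
Qed.

(** Pairs [(eta, v)] with [v] in [eta] correspond to pairs [(sigma, v)] with [v] outside [sigma],
    through [eta = v |: sigma]. *)
Lemma bd_cobd_adjoint f g :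
  \sum_eta f eta * cobd g eta = \sum_sigma bd f sigma * g sigma.
Proof.
under eq_bigr => eta _ do rewrite /cobd big_distrr /=.
under [RHS]eq_bigr => sigma _ do rewrite /bd big_distrl /=.
rewrite (exchange_big_dep xpredT) //= [RHS](exchange_big_dep xpredT) //=.
apply: eq_bigr => v _.
rewrite (reindex_onto (fun sigma => v |: sigma) (fun eta => eta :\ v)) /=;
  last by move=> eta; apply: setD1K.
apply: eq_big => [sigma|sigma /andP[_ /eqP->]//].
rewrite setU11 inE /=; apply/eqP/idP => [<-|]; first by rewrite !inE eqxx.
exact: setU1K.
Qed.

Lemma cobd_cobd f tau : cobd (cobd f) tau = 0.
Proof.
apply: (@sum_symmetric_F2 _ _ (fun v w => f (tau :\ v :\ w))) => v w.
by rewrite !setDDl setUC.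
Qed.

(* [f] is a cone over [tau] in [Y], [c] giving the cones over the facets of [tau]. *)
Definition cone_at Y (c : {set V} -> {set V} -> 'F_2) tau f : Prop :=
  (forall eta, f eta != 0 -> eta \in faces Y #|tau|.+1) /\
  (forall sigma, bd f sigma = (sigma == tau)%:R + cobd (c^~ sigma) tau).

(** The empty face is included and starts the recursion: its cone is a set of vertices of odd
    size. *)
Definition cone n X c : Prop := forall tau, tau \in X -> (#|tau| <= n)%N ->
  cone_at X c tau (c tau).

End SetChains.

(** * Cones inside the acyclic subcomplexes *)

Section ConeExistence.
Variables (V S : finType) (n : nat) (X : {set {set V}}).
Variables (G : {group {perm V}}) (to : action G S).
Variable B : S -> {set V} -> {set {set V}}.
Hypothesis HB : building_like n X to B.
Implicit Types (sigma tau eta : {set V}).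

(** The prescribed boundary [z], namely [tau] plus the cones over its facets, is a cycle supported
    in [B s tau], by [bl_mem] and [bl_mono]; acyclicity fills it. *)
Lemma cone_at_exists s c tau : tau \in X -> (#|tau| <= n)%N ->
    (forall v, v \in tau -> cone_at (B s (tau :\ v)) c (tau :\ v) (c (tau :\ v))) ->
  exists f, cone_at (B s tau) c tau f.
Proof.
move=> tX tn cP; have [_ Xdown] := pure_complex_sc (bl_pure HB).
pose z eta := (eta == tau)%:R + cobd (c^~ eta) tau.
have [Bsc BX] := bl_subcomplex HB s tX tn.
have [eta|sigma|f f1 f2] := @fill_cycle _ (B s tau) #|tau| z Bsc
  (bl_acyclic HB s tX tn (leqnn _)); last by exists f.
  apply: contraNT => eB; rewrite /z; have [et|_] := eqVneq eta tau.
    by case/negP: eB; apply/facesP; rewrite et; split=> //; apply: (bl_mem HB).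
  rewrite add0r /cobd big1 // => v vt; apply/eqP; apply: contraNT eB => ce.
  have [/(_ eta ce)+ _] := cP v vt.
  have -> : #|tau :\ v|.+1 = #|tau| by rewrite (cardsD1 v tau) vt.
  by apply/subsetP/sub_faces/(bl_mono HB) => //; apply: subD1set.
rewrite bdD bd_delta bd_sum.
rewrite [X in _ + X](eq_bigr (fun v => (sigma == tau :\ v)%:R + cobd (c^~ sigma) (tau :\ v)));
  last by move=> v vt; have [_] := cP v vt; apply.
(* The facets of [tau] occur twice and cancel. What remains is a sum over ordered pairs of distinct
   vertices of [tau], symmetric in the pair. *)
rewrite big_split /= addrA addF2 add0r.
apply: (@sum_symmetric_F2 _ _ (fun v w => c (tau :\ v :\ w) sigma)) => v w.
by rewrite !setDDl setUC.
Qed.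

Lemma cone_in_subcomplexes s :
  exists c, forall tau, tau \in X -> (#|tau| <= n)%N ->
    cone_at (B s tau) c tau (c tau).
Proof.
suff cm m : exists c, forall tau, tau \in X -> (#|tau| <= n)%N ->
    (#|tau| < m)%N -> cone_at (B s tau) c tau (c tau).
  by have [c cP] := cm n.+1; exists c => tau tX tn; apply: cP.
have [_ Xdown] := pure_complex_sc (bl_pure HB).
elim: m => [|m [c cP]]; first by exists (fun _ _ => 0).
(* The choice ranges over all subsets at once, so sets other than the faces of size [m] receive the
   zero chain. *)
have /fin_all_exists[y yP] tau : exists f, tau \in X -> (#|tau| <= n)%N ->
    #|tau| = m -> cone_at (B s tau) c tau f.
  have [tX|] := boolP (tau \in X); last by exists (fun _ => 0).
  have [tn|] := boolP (#|tau| <= n)%N; last by exists (fun _ => 0).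
  have [tm|/eqP] := eqVneq #|tau| m; last by exists (fun _ => 0).
  have [|f fP] := @cone_at_exists s c tau tX tn; last by exists f.
  move=> v vt; have tv : (#|tau :\ v| < #|tau|)%N by rewrite [X in (_ < X)%N](cardsD1 v) vt.
  apply: cP; first exact: Xdown tX (subD1set _ _).
    exact: leq_trans (ltnW tv) tn.
  by rewrite -tm.
exists (fun tau => if (#|tau| < m)%N then c tau else y tau) => tau tX tn tm.
have : cone_at (B s tau) c tau (if (#|tau| < m)%N then c tau else y tau).
  have [tm'|mt] := ltnP #|tau| m; first exact: cP.
  by apply: yP => //; apply/eqP; rewrite eqn_leq mt -ltnS tm.
(* The cone condition at [tau] reads the family only at facets of [tau], which have fewer than [m]
   vertices, where the new family equals [c]. *)
case=> f1 f2; split=> // sigma; rewrite f2; congr (_ + _); apply: eq_bigr => v vt.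
by move: tm; rewrite (cardsD1 v) vt add1n ltnS => ->.
Qed.

(** The cone condition in [X] is the part carried over to conjugates; the finer support in [B s tau]
    is kept for the count by [orbit_bound]. *)
Lemma cone_exists s : exists c, cone n X c /\
  (forall tau eta, tau \in X -> (#|tau| <= n)%N -> c tau eta != 0 ->
     eta \in faces (B s tau) #|tau|.+1).
Proof.
have [c cP] := cone_in_subcomplexes s; exists c; split=> [tau tX tn|tau eta tX tn].
  have [cs cb] := cP tau tX tn; split=> // eta /cs.
  by apply/subsetP/sub_faces; have [] := bl_subcomplex HB s tX tn.
by have [cs _] := cP tau tX tn; apply: cs.
Qed.

End ConeExistence.

(** * The contracting homotopy dual to a cone *)

Section Homotopy.
Variables (V : finType) (n : nat) (X : {set {set V}}).
Hypothesis Xsc : simplicial_complex X.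
Variable c : {set V} -> {set V} -> 'F_2.
Hypothesis cP : cone n X c.
Implicit Types (sigma tau eta : {set V}).

Definition cone_op m (phi : cochain X m.+1) : cochain X m :=
  [ffun tau : face X m => \sum_eta c (val tau) eta * extend phi eta].

Lemma cone_opE m (phi : cochain X m.+1) tau : tau \in faces X m ->
  extend (cone_op phi) tau = \sum_eta c tau eta * extend phi eta.
Proof.
move=> tX.
by rewrite -[tau]/(val (exist (fun s => s \in faces X m) tau tX)) extendE ffunE.
Qed.

(** By adjointness, evaluating [coboundary phi] on the cone over [tau] is evaluating [phi] on its
    boundary, that is, on [tau] and on the cones over its facets. *)
Lemma cone_homotopy m (phi : cochain X m.+1) : (m < n)%N ->
  phi + coboundary (cone_op phi) = cone_op (coboundary phi).
Proof.
move=> mn; apply/ffunP=> u; rewrite ffunE -!extendE.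
have uX := valP u; move: (val u) uX => tau tF; have /facesP[tX tm] := tF.
have [_ Xdown] := Xsc; have tn : (#|tau| <= n)%N by rewrite tm.
have [cs cb] := cP tX tn.
rewrite coboundaryE // cone_opE //.
under [RHS]eq_bigr => eta _.
  (* The two coboundaries are compared only on faces of [X]; at other sets [c tau] vanishes. *)
  rewrite (_ : _ * _ = c tau eta * cobd (extend phi) eta); last first.
    have [->|/cs] := eqVneq (c tau eta) 0; first by rewrite !mul0r.
    by rewrite tm => /coboundaryE->.
  over.
rewrite bd_cobd_adjoint.
under [RHS]eq_bigr => sigma _ do rewrite cb mulrDl /cobd big_distrl /=.
rewrite big_split /=; congr (_ + _).
  rewrite (bigD1 tau) //= eqxx mul1r big1 ?addr0 // => sigma /negPf->.
  by rewrite mul0r.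
rewrite exchange_big; apply: eq_bigr => v vt; apply: cone_opE.
apply/facesP; split; first exact: Xdown tX (subD1set _ _).
by move: tm; rewrite (cardsD1 v) vt => -[].
Qed.

End Homotopy.

(** Over each point of the orbit, the fibre of [g] mapped to [to x g] is a coset of the
    stabilizer. *)
Lemma card_act_preimage (aT : finGroupType) (rT : finType) (to : {action aT &-> rT})
    (G : {group aT}) (x : rT) (P : pred rT) :
  #|[set g in G | P (to x g)]|
    = (#|[set y in orbit to G x | P y]| * #|'C_G[x | to]%g|)%N.
Proof.
rewrite -sum1_card (partition_big (to x) (mem [set y in orbit to G x | P y])) /=; last first.
  by move=> g; rewrite !inE => /andP[gG ->]; rewrite mem_orbit.
rewrite -sum_nat_const; apply: eq_bigr => y; rewrite inE => /andP[/orbitP[a aG <-] Pa].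
rewrite sum1dep_card -[RHS](card_rcoset _ a) -amove_act ?subsetT //.
congr #|pred_of_set _|; apply/setP=> g; rewrite !inE.
by case: eqP => [->|]; rewrite ?Pa ?andbT ?andbF.
Qed.

(** * Minima over finite types *)

Section FinMin.
Variables (I : finType) (P : pred I) (F : I -> rat).

Lemma fin_min_le i : P i -> fin_min P F <= F i.
Proof.
rewrite /fin_min => Pi; case: pickP => [i0 Pi0|/(_ i)]; last by rewrite Pi.
by case: arg_minP => // j _; apply.
Qed.

Lemma fin_min_attained i0 : P i0 -> exists2 i, P i & fin_min P F = F i.
Proof.
rewrite /fin_min => Pi0; case: pickP => [i Pi|/(_ i0)]; last by rewrite Pi0.
by case: arg_minP => // j Pj _; exists j.
Qed.

Lemma fin_min_ge0 : (forall i, P i -> 0 <= F i) -> 0 <= fin_min P F.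
Proof.
by rewrite /fin_min => F0; case: pickP => // i Pi; case: arg_minP => // j /F0.
Qed.

End FinMin.

(** * Transport of cones and weights by automorphisms *)

Section PermutedCones.
Variable V : finType.
Implicit Types (sigma tau eta : {set V}) (X : {set {set V}}) (g : {perm V}).

Lemma setactP_imset g tau : ('P^*)%act tau g = g @: tau.
Proof. exact: eq_imset. Qed.

Lemma imset_perm_inj g : injective (fun tau => g @: tau).
Proof. by apply: imset_inj; apply: perm_inj. Qed.

Lemma imset_perm_subset g sigma tau : (g @: sigma \subset g @: tau) = (sigma \subset tau).
Proof.
apply/idP/idP => [/subsetP st|]; last exact: imsetS.
by apply/subsetP=> v /(imset_f g)/st; rewrite mem_imset //; apply: perm_inj.
Qed.

Lemma bd_perm g (f : {set V} -> 'F_2) sigma :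
  bd (fun eta => f (g @: eta)) sigma = bd f (g @: sigma).
Proof.
rewrite /bd [RHS](reindex_inj (@perm_inj _ g)) /=.
apply: eq_big => [v|v _]; first by rewrite !inE mem_imset //; apply: perm_inj.
by rewrite imsetU1.
Qed.

Lemma cobd_perm g (f : {set V} -> 'F_2) tau :
  cobd (fun eta => f (g @: eta)) tau = cobd f (g @: tau).
Proof.
rewrite /cobd [RHS](reindex_inj (@perm_inj _ g)) /=.
apply: eq_big => [v|v vt]; first by rewrite mem_imset //; apply: perm_inj.
congr f; apply/setP=> w; rewrite -(permKV g w).
by rewrite !inE !mem_imset ?inE ?(inj_eq (@perm_inj _ g)) //; apply: perm_inj.
Qed.

(** The new chain at [tau] is the inverse image under [g] of the cone over [g @: tau]; [bd] and
    [cobd] commute with relabelling of vertices. *)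
Lemma cone_perm n X c g : (forall m tau, (g @: tau \in faces X m) = (tau \in faces X m)) ->
  cone n X c -> cone n X (fun tau eta => c (g @: tau) (g @: eta)).
Proof.
move=> gX cP tau tX tn.
have ct : #|g @: tau| = #|tau| by apply: card_imset; apply: perm_inj.
have gtX : g @: tau \in X.
  by have /facesP[] : g @: tau \in faces X #|tau| by rewrite gX; apply/facesP.
have [|cs cb] := cP _ gtX; first by rewrite ct.
split=> [eta /cs|sigma]; first by rewrite ct gX.
by rewrite bd_perm cb (inj_eq (@imset_perm_inj g)) -cobd_perm.
Qed.

Lemma weight_perm n X g : (forall m tau, (g @: tau \in faces X m) = (tau \in faces X m)) ->
  forall sigma, weight n X (g @: sigma) = weight n X sigma.
Proof.
move=> gX sigma; rewrite /weight card_imset; last exact: perm_inj.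
congr (_%:R / _).
rewrite -!sum1dep_card (reindex_inj (@imset_perm_inj g)) /=.
by apply: eq_bigl => tau; rewrite gX imset_perm_subset.
Qed.

End PermutedCones.

(** * Weights and norms *)

Section Norms.
Variables (V : finType) (n : nat) (X : {set {set V}}).
Implicit Types (sigma tau eta : {set V}).

Lemma weight_ge0 sigma : 0 <= weight n X sigma.
Proof. by rewrite divr_ge0 // ler0n. Qed.

Lemma normE m (phi : cochain X m) :
  norm n phi = \sum_(sigma in faces X m | extend phi sigma != 0) weight n X sigma.
Proof. by rewrite big_sub_cond; apply: eq_bigl => u; rewrite extendE. Qed.

Lemma norm_ge0 m (phi : cochain X m) : 0 <= norm n phi.
Proof. by apply: sumr_ge0 => u _; apply: weight_ge0. Qed.

(** Double counting: an [n]-face has ['C(n.+1, m)] subsets of size [m]. *)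
Lemma sum_weight_le1 m : \sum_(sigma in faces X m) weight n X sigma <= 1.
Proof.
have -> : \sum_(sigma in faces X m) weight n X sigma
    = (\sum_(sigma in faces X m) #|[set tau in faces X n.+1 | sigma \subset tau]|)%N%:R
        / ('C(n.+1, m) * #|faces X n.+1|)%:R.
  rewrite natr_sum big_distrl /=; apply: eq_bigr => sigma /facesP[_ sm].
  by rewrite /weight sm.
set D := (_ * _)%N.
suff le_D : (\sum_(sigma in faces X m)
    #|[set tau in faces X n.+1 | sigma \subset tau]| <= D)%N.
  (* A zero denominator makes the quotient 0 by convention. *)
  have [->|D0] := posnP D; first by rewrite invr0 mulr0.
  by rewrite ler_pdivrMr ?ltr0n // mul1r ler_nat.
under eq_bigr => sigma _ do rewrite -sum1dep_card big_mkcondr.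
rewrite exchange_big /= /D mulnC -sum_nat_const; apply: leq_sum => tau /facesP[_ tn].
rewrite -big_mkcondr sum1dep_card -tn -cards_draws; apply/subset_leq_card/subsetP=> sigma.
by rewrite !inE => /andP[/andP[_ ->] ->].
Qed.

End Norms.

(** * Averaging over the group and the expansion bound *)

Section Expansion.
Variables (V S : finType) (n : nat) (X : {set {set V}}).
Variables (G : {group {perm V}}) (to : action G S).
Variable B : S -> {set V} -> {set {set V}}.
Hypothesis HB : building_like n X to B.
Implicit Types (sigma tau eta : {set V}) (g : {perm V}).

Lemma faces_perm g : g \in G -> forall m tau, (g @: tau \in faces X m) = (tau \in faces X m).
Proof.
move=> gG m tau; rewrite !inE card_imset; last exact: perm_inj.
by rewrite -setactP_imset (astabs_act _ (subsetP (bl_aut HB) g gG)).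
Qed.

Lemma face_in_facet sigma : sigma \in X -> exists2 tau, tau \in faces X n.+1 & sigma \subset tau.
Proof.
move=> sX; have [tau tmax st] := maxset_exists (P := mem X) sX.
exists tau => //; apply/facesP; split; first exact: maxsetp tmax.
exact: pure_complex_facet (bl_pure HB) _ tmax.
Qed.

Lemma weight_gt0 sigma : sigma \in X -> 0 < weight n X sigma.
Proof.
move=> sX; have [tau tF st] := face_in_facet sX; have /facesP[_ tn] := tF.
rewrite divr_gt0 // ltr0n.
  by apply/card_gt0P; exists tau; rewrite inE tF.
rewrite muln_gt0 bin_gt0 -tn subset_leq_card //=.
by apply/card_gt0P; exists tau; rewrite tn.
Qed.

(** By transitivity every [n]-face contains a translate of [eta], and each translate lies in as many
    [n]-faces as [eta] does. *)
Lemma card_facets_le_orbit eta : eta \in X ->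
  (#|faces X n.+1|
    <= #|orbit ('P^*)%act G eta| * #|[set tau in faces X n.+1 | eta \subset tau]|)%N.
Proof.
move=> eX; have [tau0 t0F et0] := face_in_facet eX.
apply: (@leq_trans (\sum_(tau in faces X n.+1)
   \sum_(xi in orbit ('P^*)%act G eta | xi \subset tau) 1)%N).
  rewrite -sum1_card; apply: leq_sum => tau tF.
  have [g gG ->] := atransP2 (bl_transitive HB) t0F tF.
  rewrite (bigD1 (('P^*)%act eta g)) //= mem_orbit //=.
  by rewrite !setactP_imset imsetS.
rewrite (exchange_big_dep (mem (orbit ('P^*)%act G eta))) /=; last by move=> ? ? _ /andP[].
rewrite -sum_nat_const; apply: leq_sum => xi xiO; have /orbitP[g gG gxi] := xiO.
rewrite (eq_bigl (fun tau => (tau \in faces X n.+1) && (xi \subset tau))); last first.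
  by move=> tau; rewrite xiO.
rewrite -sum1dep_card (reindex_inj (@imset_perm_inj _ g)) /= leq_eqVlt; apply/orP; left.
apply/eqP/eq_bigl => tau.
by rewrite faces_perm // -gxi setactP_imset imset_perm_subset.
Qed.

Lemma card_stab_le_weight m eta : eta \in faces X m -> (m <= n.+1)%N ->
  #|'C_G[eta | 'P^*]%g|%:R <= #|G|%:R * 'C(n.+1, m)%:R * weight n X eta.
Proof.
move=> /facesP[eX em] mn; have := card_facets_le_orbit eX.
have [tau tF _] := face_in_facet eX.
have F0 : (0 < #|faces X n.+1|)%N by apply/card_gt0P; exists tau.
have C0 : 'C(n.+1, m)%:R != 0 :> rat by rewrite pnatr_eq0 -lt0n bin_gt0.
rewrite /weight em natrM invfM -(card_orbit_stab ('P^*)%act G eta).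
set o := #|orbit _ _ _|; set f := #|faces _ _|; set d := #|[set _ in _ | _]|.
set t := #|_| => fod.
(* Here [#|G|] is [o * t] by orbit-stabilizer, and the claim reduces to [f <= o * d], which is
   [fod]. *)
have -> : (o * t)%:R * 'C(n.+1, m)%:R * (d%:R * ('C(n.+1, m)%:R^-1 * f%:R^-1))
    = (o * t * d)%:R / f%:R :> rat.
  by rewrite [d%:R * _]mulrCA [LHS]mulrA mulfK // [in RHS]natrM mulrA.
rewrite ler_pdivlMr ?ltr0n // -natrM ler_nat mulnAC mulnC.
by rewrite leq_mul2r fod orbT.
Qed.

Lemma norm_gt0 m (phi : cochain X m) : phi != 0 -> 0 < norm n phi.
Proof.
move=> phi0; rewrite lt_neqAle norm_ge0 andbT eq_sym psumr_neq0 => [|u _];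
  last exact: weight_ge0.
have [u u0] : exists u, phi u != 0.
  apply/existsP; apply: contraNT phi0 => /existsPn phi0; apply/eqP/ffunP=> u.
  by rewrite ffunE; apply/eqP/negPn/phi0.
apply/hasP; exists u; rewrite ?mem_index_enum // u0 weight_gt0 //.
by have /facesP[] := valP u.
Qed.

(** Gives positive denominators in [expansion]: if the minimizing representative were 0, [phi] would
    be the coboundary of [psi]. *)
Lemma cohomology_norm_gt0 k (phi : cochain X k.+1) :
  phi \notin coboundaries X k -> 0 < cohomology_norm n phi.
Proof.
move=> phiB; rewrite /cohomology_norm.
have [psi _ ->] := @fin_min_attained _ predT
  (fun psi : cochain X k => norm n (phi + coboundary psi)) 0 isT.
apply: norm_gt0; apply: contra phiB => /eqP/ffunP e; apply/imsetP; exists psi => //.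
apply/ffunP=> u; have := e u; rewrite !ffunE => /eqP.
by rewrite addr_eq0 => /eqP->; apply/esym/eqP; rewrite -addr_eq0 addF2.
Qed.

(** A nonzero value at [tau] forces the cone over [tau] to meet the support of [psi], so the inner
    count is at least 1. *)
Lemma norm_cone_op_le c k (psi : cochain X k.+2) :
  norm n (cone_op c psi) <=
    \sum_(tau in faces X k.+1) weight n X tau *
      \sum_(eta in faces X k.+2 | extend psi eta != 0) (c tau eta != 0)%:R.
Proof.
rewrite normE big_mkcondr; apply: ler_sum => tau tF.
have sum0 : 0 <= \sum_(eta in faces X k.+2 | extend psi eta != 0) (c tau eta != 0)%:R :> rat.
  by apply: sumr_ge0 => eta _; apply: ler0n.
rewrite cone_opE //; case: ifP => [nz|_]; last by rewrite mulr_ge0 ?weight_ge0.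
have [eta ceta] : exists eta, c tau eta * extend psi eta != 0.
  apply/existsP; apply: contraTT nz => /existsPn c0; rewrite negbK big1 // => eta _.
  exact/eqP/negPn/c0.
rewrite mulf_eq0 negb_or in ceta; have /andP[c0 psi0] := ceta.
rewrite -[leLHS]mulr1 ler_wpM2l ?weight_ge0 // (bigD1 eta) /=; last first.
  by rewrite psi0 andbT; apply: contraR psi0 => /extend_out->.
by rewrite c0 lerDl; apply: sumr_ge0 => xi _; apply: ler0n.
Qed.

Lemma card_orbit_cone_le (c : {set V} -> {set V} -> 'F_2) s k tau eta :
    (forall tau eta, tau \in X -> (#|tau| <= n)%N -> c tau eta != 0 ->
       eta \in faces (B s tau) #|tau|.+1) ->
    (k < n)%N -> tau \in faces X k.+1 -> eta \in faces X k.+2 ->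
  (#|[set xi in orbit ('P^*)%act G eta | c tau xi != 0%R]| <= orbit_bound X G B k)%N.
Proof.
move=> cB kn tF eF; have /facesP[tX tk] := tF.
apply: leq_trans (leq_bigmax_cond (P := mem (faces X k.+2)) _ eF).
apply: leq_trans (leq_bigmax_cond (P := predT) s isT).
apply: leq_trans (leq_bigmax_cond (P := mem (faces X k.+1)) _ tF).
apply/subset_leq_card/subsetP=> xi; rewrite !inE => /andP[-> /cB].
by rewrite tk => /(_ tX kn); rewrite inE.
Qed.

Lemma cohomology_norm_le (s : S) k (phi : cochain X k.+1) : (k < n)%N ->
  cohomology_norm n phi
    <= ('C(n.+1, k.+2) * orbit_bound X G B k)%:R * norm n (coboundary phi).
Proof.
move=> kn; have [c [cP cB]] := cone_exists HB s.
have Xsc := pure_complex_sc (bl_pure HB).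
set psi := coboundary phi; set a := orbit_bound X G B k.
pose supp eta := (eta \in faces X k.+2) && (extend psi eta != 0).
have N_le g : g \in G -> cohomology_norm n phi <=
    \sum_(tau in faces X k.+1) weight n X tau *
      \sum_(eta | supp eta) (c tau (g @: eta) != 0)%:R.
  move=> gG; have gX := faces_perm gG; have cgP := cone_perm gX cP.
  (* The competitor in the minimum is the homotopy of the cone conjugated by [g]. *)
  apply: le_trans (fin_min_le _
    (i := cone_op (fun tau eta => c (g @: tau) (g @: eta)) phi) isT) _.
  rewrite (cone_homotopy Xsc cgP) //.
  apply: le_trans (norm_cone_op_le _ _) _.
  (* Weights are invariant under [g], so [g @: tau] may replace [tau]. This leaves [tau] fixed and
     only [eta] moving when the sum over [G] is taken. *)
  rewrite [leRHS](reindex_inj (@imset_perm_inj _ g)) /= le_eqVlt; apply/orP; left.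
  by apply/eqP/eq_big => [tau|tau _]; rewrite ?gX ?weight_perm.
have G0 : 0 < #|G|%:R :> rat by rewrite ltr0n cardG_gt0.
rewrite -(ler_pM2l G0).
have -> : #|G|%:R * cohomology_norm n phi = \sum_(g in G) cohomology_norm n phi.
  by rewrite sumr_const mulr_natl.
apply: le_trans (ler_sum _ N_le) _.
have count_le tau : tau \in faces X k.+1 ->
    \sum_(g in G) \sum_(eta | supp eta) (c tau (g @: eta) != 0)%:R
      <= #|G|%:R * (('C(n.+1, k.+2) * a)%:R * norm n psi) :> rat.
  move=> tF; rewrite exchange_big normE !mulr_sumr /=; apply: ler_sum => eta /andP[eF _].
  rewrite -natr_sum -big_mkcondr /= sum1dep_card.
  under eq_finset => g do rewrite -setactP_imset.
  rewrite (card_act_preimage _ _ _ (fun xi => c tau xi != 0)) natrM.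
  apply: (@le_trans _ _ (a%:R * #|'C_G[eta | 'P^*]%g|%:R)).
    by rewrite ler_wpM2r ?ler0n // ler_nat (card_orbit_cone_le cB).
  have -> : #|G|%:R * (('C(n.+1, k.+2) * a)%:R * weight n X eta)
      = a%:R * (#|G|%:R * 'C(n.+1, k.+2)%:R * weight n X eta).
    by rewrite mulnC natrM -!mulrA mulrCA.
  by rewrite ler_wpM2l ?ler0n // card_stab_le_weight.
rewrite exchange_big /=; under eq_bigr => tau _ do rewrite -big_distrr /=.
apply: le_trans (ler_sum _ (fun tau tF => ler_wpM2l (weight_ge0 n X tau) (count_le tau tF))) _.
rewrite -big_distrl /= -[leRHS]mul1r ler_wpM2r ?sum_weight_le1 //.
by rewrite !mulr_ge0 ?ler0n ?norm_ge0.
Qed.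

(** Rules out the default value of [fin_min]. The indicator of one facet of a face [tau] has
    coboundary 1 at [tau], whereas coboundaries are cocycles. *)
Lemma exists_non_coboundary k : (k < n)%N ->
  exists phi : cochain X k.+1, phi \notin coboundaries X k.
Proof.
move=> kn; have Xsc := pure_complex_sc (bl_pure HB); have [X0 Xdown] := Xsc.
have [T /facesP[TX Tn] _] := face_in_facet X0.
have /card_gt0P[tau] : (0 < #|[set A : {set V} | A \subset T & #|A| == k.+2]|)%N.
  by rewrite cards_draws bin_gt0 Tn.
rewrite inE => /andP[tT /eqP tk]; have tX := Xdown _ _ TX tT.
have tF : tau \in faces X k.+2 by apply/facesP.
have /card_gt0P[v vt] : (0 < #|tau|)%N by rewrite tk.
pose phi : cochain X k.+1 := [ffun u => (val u == tau :\ v)%:R].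
have facetF w : w \in tau -> tau :\ w \in faces X k.+1.
  move=> wt; apply/facesP; split; first exact: Xdown tX (subD1set _ _).
  by move: tk; rewrite (cardsD1 w) wt => -[].
have dphi : cobd (extend phi) tau = 1.
  have phiE w (wt : w \in tau) : extend phi (tau :\ w) = (w == v)%:R.
    rewrite -[tau :\ w]/(val (exist (fun s => s \in faces X k.+1) _ (facetF w wt))).
    by rewrite extendE ffunE /= (inj_in_eq (@setD1_in_inj _ tau)).
  rewrite /cobd (bigD1 v) //= phiE // eqxx big1 ?addr0 // => w /andP[wt /negPf wv].
  by rewrite phiE // wv.
exists phi; apply/imsetP=> -[psi _ phiE].
suff : cobd (extend phi) tau = 0 by rewrite dphi => /eqP; rewrite oner_eq0.
rewrite phiE -[RHS](@cobd_cobd _ (extend psi) tau); apply: eq_bigr => w wt.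
by rewrite coboundaryE // facetF.
Qed.

End Expansion.

Theorem theorem1p3 (V S : finType) (n : nat) (X : {set {set V}})
  (G : {group {perm V}}) (to : action G S)
  (B : S -> {set V} -> {set {set V}})
  (HB : building_like n X to B) (k : nat) (hk : (k < n)%N) :
  ('C(n.+1, k.+2) * orbit_bound X G B k)%:R^-1 <= expansion n X k.
Proof.
(* When the product is 0 its inverse is 0 by convention, and nonnegativity of the expansion
   suffices. *)
have [Ca0|Ca0] := posnP ('C(n.+1, k.+2) * orbit_bound X G B k).
  rewrite Ca0 invr0; apply: fin_min_ge0 => phi phiB.
  by rewrite divr_ge0 ?norm_ge0 // ltW // (cohomology_norm_gt0 HB).
(* A positive bound forces [S] to be inhabited, since a maximum over an empty [S] is 0. *)
have [s _] : exists s : S, true.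
  apply/existsP; apply: contraTT Ca0 => /existsPn S0.
  rewrite -eqn0Ngt muln_eq0; apply/orP; right; apply/eqP/big1 => eta _.
  by apply: big1 => s; have := S0 s.
have [phi0 phi0B] := exists_non_coboundary HB hk.
have [phi phiB] := fin_min_attained
  (fun phi => norm n (coboundary phi) / cohomology_norm n phi)
  (P := [pred phi : cochain X k.+1 | phi \notin coboundaries X k]) phi0B.
rewrite /expansion => ->.
rewrite ler_pdivlMr ?(cohomology_norm_gt0 HB) // mulrC ler_pdivrMr ?ltr0n // mulrC.
exact: (cohomology_norm_le HB s).
Qed.
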